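(* Assume that $G:\mathbb{R}^p\to\mathbb{R}^p$ is $\frac1L$-co-coercive with $L>0$ and that $\mathrm{zer}(G):=\{y: Gy=0\}\ne\emptyset$. Let $\omega>2$ and $\gamma\in\left(0,\frac1L\right)$ be given constants, let $y_0\in\mathbb{R}^p$, $x_0:=y_0$, and let $\{(x_k,y_k)\}$ be generated, for $k\ge 0$, by $$\begin{cases} x_{k+1} := y_k-\gamma Gy_k,\\ y_{k+1} := x_{k+1}+\theta_k(x_{k+1}-x_k)+\nu_k(y_k-x_{k+1}),\end{cases}$$ with $\theta_k:=\frac{k+1}{k+2\omega+2}$ and $\nu_k:=\frac{k+\omega+2}{k+2\omega+2}\in(0,1)$. Then $$\begin{aligned} &\sum_{k=0}^{\infty}(k+\omega+1)\|x_{k+1}-x_k\|^2<+\infty \quad\text{and}\quad \|x_{k+1}-x_k\|^2=o\left(\tfrac1{k^2}\right),\\ &\sum_{k=0}^{\infty}(k+2\omega+1)\|y_k-x_k\|^2<+\infty \quad\text{and}\quad \|y_k-x_k\|^2=o\left(\tfrac1{k^2}\right),\\ &\sum_{k=0}^{\infty}(k+\omega+1)\|Gy_k\|^2<+\infty \quad\text{and}\quad \|Gy_k\|^2=o\left(\tfrac1{k^2}\right),\\ &\sum_{k=0}^{\infty}(k+\omega+1)\|Gx_k\|^2<+\infty \quad\text{and}\quad \|Gx_k\|^2=o\left(\tfrac1{k^2}\right),\\ &\sum_{k=0}^{\infty}(k+\omega)\|y_{k+1}-y_k\|^2<+\infty \quad\text{and}\quad \|y_{k+1}-y_k\|^2=o\left(\tfrac1{k^2}\right),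 \end{aligned}$$ as $k\to\infty$. Consequently, both $\{x_k\}$ and $\{y_k\}$ converge to a point $y^\star\in\mathrm{zer}(G)$.
   Context: $G$ is $\frac1L$-co-coercive if $\langle Gx-Gy,x-y\rangle\ge \frac1L\|Gx-Gy\|^2$ for all $x,y\in\mathbb{R}^p$. $\|\cdot\|$ is the Euclidean norm. *)

(* Defs.v *)
From mathcomp Require Import all_boot all_order all_algebra.
From mathcomp Require Import all_classical all_reals all_analysis.
Set Implicit Arguments.
Unset Strict Implicit.
Unset Printing Implicit Defensive.
Import Order.TTheory GRing.Theory Num.Theory.
Import numFieldNormedType.Exports.
Local Open Scope classical_set_scope.
Local Open Scope ring_scope.

Definition dotv (R : realType) (p : nat) (u v : 'rV[R]_p) : R :=
  \sum_(i < p) u 0 i * v 0 i.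

(* The norm `|u| that the library puts on 'rV[R]_p is the sup norm, hence this
   separate Euclidean norm; both induce the library topology of 'rV[R]_p. *)
Definition enorm (R : realType) (p : nat) (u : 'rV[R]_p) : R :=
  Num.sqrt (dotv u u).

Definition cocoercive (R : realType) (p : nat) (c : R)
    (G : 'rV[R]_p -> 'rV[R]_p) : Prop :=
  forall x y, c * enorm (G x - G y) ^+ 2 <= dotv (G x - G y) (x - y).

Definition zer (R : realType) (p : nat) (G : 'rV[R]_p -> 'rV[R]_p) :
    set 'rV[R]_p :=
  [set y | G y = 0].

Definition theta (R : realType) (omega : R) (k : nat) : R :=
  (k%:R + 1) / (k%:R + 2 * omega + 2).

Definition nu (R : realType) (omega : R) (k : nat) : R :=
  (k%:R + omega + 2) / (k%:R + 2 * omega + 2).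

(* The value of the comparison function at k = 0 is irrelevant here, the
   relation being an eventual one. *)
Definition little_o_inv_sq (R : realType) (a : nat -> R) : Prop :=
  a =o_\oo (fun k : nat => (k%:R ^+ 2)^-1 : R).

(* Main.v *)
Require Import Defs.
From mathcomp Require Import all_boot all_order all_algebra.
From mathcomp Require Import all_classical all_reals all_analysis.
From mathcomp Require Import ring lra.
Set Implicit Arguments.
Unset Strict Implicit.
Unset Printing Implicit Defensive.
Import Order.TTheory GRing.Theory Num.Theory.
Import numFieldNormedType.Exports.
Local Open Scope classical_set_scope.
Local Open Scope ring_scope.

(** Put [v_k = y_k - x_k], [e_k = gamma G y_k], [T_k = k + 2 omega + 1] and
    [D_k = |v_k|^2 + |e_k|^2].  The scheme reads [x_{k+1} = x_k + v_k - e_k] and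
    [T_{k+1} v_{k+1} = (T_k - 2 omega) v_k + (omega + 1) e_k].  Co-coercivity
    between [y_{k+1}] and [y_k] makes
    [Q_k = T_k^2 (2 <v_k, e_k> - |e_k|^2)] nondecreasing up to [O(T_k D_k)].
    For a zero [z] of [G] the energy
    [T_k^2 |v_k|^2 / 2 + omega T_k <x_k - z, v_k> + omega^2 |x_k - z|^2 - Q_k / 4]
    is, for large [k], bounded below by a positive multiple of
    [T_k^2 D_k + |x_k - z|^2] and decreases by at least [T_k D_k / 32].  Hence
    [T_k D_k] is summable; [T_k^2 |v_k|^2] and [Q_k] then converge, necessarily
    to [0] since [1 / T_k] is not summable, so that [T_k^2 D_k] tends to [0].
    All the sequences of the theorem are [O(D_k)].  Finally the energy limit gives
    the convergence of [|x_k - z|] for every zero [z], and Opial's argument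
    concludes. *)

(** * Real sequences: bounded partial sums, quasi-monotone convergence, rates *)

Section Sequences.
Context {R : realType}.
Implicit Types a b u z : nat -> R.

Definition bounded_sums a := exists M, forall n, \sum_(0 <= k < n) a k <= M.

Lemma bounded_sums_le (K : nat) (c : R) a b :
  0 <= c -> (forall k, 0 <= b k) -> (forall k, (K <= k)%N -> a k <= c * b k) ->
  bounded_sums b -> bounded_sums a.
Proof.
(* Below [K] nothing compares [a] with [b]; the absolute values of those terms are paid for
   separately. *)
move=> c0 b0 ab [M bM]; exists (\sum_(0 <= k < K) `|a k| + c * M) => n.
have := ler_wpM2l c0 (bM n); rewrite mulr_sumr => H.
suff : \sum_(0 <= k < n) a k <=
    \sum_(0 <= k < K) `|a k| + \sum_(0 <= k < n) c * b k by lra.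
elim: n {H} => [|n ih].
  by rewrite !(@big_geq _ _ _ 0%N 0%N)// addr0 sumr_ge0.
rewrite !big_nat_recr //= addrA.
have [Kn|nK] := leqP K n; first by rewrite lerD// ab.
apply: (@le_trans _ _ (\sum_(0 <= i < K) `|a i|)); last first.
  rewrite -addrA lerDl addr_ge0// ?mulr_ge0// sumr_ge0// => i _.
  by rewrite mulr_ge0.
rewrite -big_nat_recr//= [leRHS](big_cat_nat _ (n := n.+1))//=.
rewrite -[leLHS]addr0 lerD// ?sumr_ge0//.
by apply: ler_sum => i _; rewrite ler_norm.
Qed.

Lemma bounded_sums_telescope (K : nat) a u :
  (forall k, (K <= k)%N -> 0 <= u k) ->
  (forall k, (K <= k)%N -> u k.+1 + a k <= u k) -> bounded_sums a.
Proof.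
move=> u0 ua; exists (\sum_(0 <= k < K) `|a k| + u K) => n.
have [Kn|nK] := leqP K n; last first.
  rewrite (big_cat_nat _ (n := n) (p := K))//=; last exact: ltnW.
  have : \sum_(0 <= k < n) a k <= \sum_(0 <= k < n) `|a k|.
    by apply: ler_sum => i _; rewrite ler_norm.
  have : 0 <= \sum_(n <= i < K) `|a i| by rewrite sumr_ge0.
  have := u0 K (leqnn K); lra.
suff : \sum_(0 <= k < n) a k + u n <= \sum_(0 <= k < K) `|a k| + u K.
  have := u0 n Kn; lra.
elim: n Kn => [|n ih]; first by rewrite leqn0 => /eqP ->;
    rewrite !(@big_geq _ _ _ 0%N 0%N).
rewrite leq_eqVlt => /predU1P[<-|].
  by rewrite lerD2r; apply: ler_sum => i _; rewrite ler_norm.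
rewrite ltnS => Kn; rewrite big_nat_recr//=.
have := ih Kn; have := ua n Kn; lra.
Qed.

(** Adding the partial sums of [a] to [z] gives a sequence that is nondecreasing and bounded above
    from rank [K] on. It converges, as does the series of [a], hence so does their difference. *)
Lemma cvgn_quasi_nondecreasing (K : nat) (B : R) a z :
  (forall k, 0 <= a k) -> bounded_sums a ->
  (forall k, (K <= k)%N -> z k <= z k.+1 + a k) ->
  (forall k, (K <= k)%N -> z k <= B) -> cvgn z.
Proof.
move=> a0 [M aM] za zB.
have cs : cvgn (series a).
  apply: nondecreasing_is_cvgn; first exact: nondecreasing_series.
  by exists M => _ [n _ <-]; exact: aM.
have cw : cvgn (fun n => z (n + K)%N + series a (n + K)%N).
  apply: nondecreasing_is_cvgn.
    apply/nondecreasing_seqP => n; rewrite addSn /series/= big_nat_recr//=.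
    have := za (n + K)%N (leq_addl _ _); lra.
  exists (B + M) => _ [n _ <-]; apply: lerD; last exact: aM.
  exact/zB/leq_addl.
move/cvg_ex : cs => [s hs]; move/cvg_ex : cw => [t ht].
apply/cvg_ex; exists (t - s); rewrite -(cvg_shiftn K).
have -> : [sequence z (n + K)%N]_n = (fun n => z (n + K)%N + series a (n + K)%N)
   - (fun n => series a (n + K)%N) by apply/funext => n; rewrite !fctE addrK.
by apply: cvgB ht _; rewrite (cvg_shiftn K).
Qed.

(** A limit [l] other than 0 would keep [|z k|] above [|l| / 2] eventually, and the harmonic series
    would have bounded partial sums. *)
Lemma cvgn_bounded_sums_harmonic z :
  cvgn z -> bounded_sums (fun k => `|z k| / k.+1%:R) -> z @ \oo --> (0 : R).
Proof.
move=> /cvg_ex[l zl] zs.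
have [l0|l0] := eqVneq l 0; first by move: zl; rewrite l0.
exfalso; apply: (@dvg_harmonic R).
have l2 : 0 < `|l| / 2 by rewrite divr_gt0// normr_gt0.
have [K _ HK] : \forall k \near \oo, `|l| / 2 <= `|z k|.
  move/cvgrPdist_lt : zl => /(_ _ l2); apply: filterS => k.
  move=> lz; have := ler_normD (l - z k) (z k); rewrite subrK; lra.
apply: nondecreasing_is_cvgn.
  by apply: nondecreasing_series => n _ _; exact: harmonic_ge0.
have [M HM] : bounded_sums (@harmonic R).
  apply: (@bounded_sums_le K (`|l| / 2)^-1) zs.
  - by rewrite invr_ge0 ltW.
  - by move=> k; rewrite divr_ge0.
  - move=> k /HK zk; rewrite /harmonic/= mulrA -[leLHS]mul1r.
    by rewrite ler_wpM2r ?invr_ge0// mulrC ler_pdivlMr// mul1r.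
by exists M => _ [n _ <-]; exact: HM.
Qed.

Lemma nneseries_lty_bounded_sums a :
  (forall k, 0 <= a k) -> bounded_sums a -> (\sum_(0 <= k <oo) (a k)%:E < +oo)%E.
Proof.
move=> a0 [M aM]; apply: (@le_lt_trans _ _ M%:E); last exact: ltry.
apply: lime_le; first by apply: is_cvg_nneseries => n _ _; rewrite lee_fin.
by apply: nearW => n; rewrite sumEFin lee_fin.
Qed.

Lemma little_o_inv_sq_cvg0 a :
  (fun k => k%:R ^+ 2 * a k) @ \oo --> (0 : R) -> little_o_inv_sq a.
Proof.
move=> ca; apply/eqoP => e e0.
move/cvgr0Pnorm_le : ca => /(_ _ e0) ca.
near=> k.
have k0 : (0 : R) < k%:R by rewrite ltr0n; near: k; exists 1%N.
have : `|k%:R ^+ 2 * a k| <= e by near: k.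
rewrite normrM (ger0_norm (_ : 0 <= k%:R ^+ 2)) ?exprn_ge0// => H.
rewrite (ger0_norm (_ : 0 <= (k%:R ^+ 2)^-1)) ?invr_ge0 ?exprn_ge0//.
by rewrite ler_pdivlMr ?exprn_gt0// mulrC.
Unshelve. all: by end_near. Qed.

End Sequences.

(** * The Euclidean inner product and its comparison with the sup norm *)

Section Euclidean.
Context {R : realType} {p : nat}.
Implicit Types u v w : 'rV[R]_p.

Lemma dotvC u v : dotv u v = dotv v u.
Proof. by apply: eq_bigr => i _; rewrite mulrC. Qed.

Lemma dotvDl u v w : dotv (u + v) w = dotv u w + dotv v w.
Proof. by rewrite /dotv -big_split; apply: eq_bigr => i _; rewrite mxE mulrDl. Qed.

Lemma dotvZl (c : R) u v : dotv (c *: u) v = c * dotv u v.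
Proof. by rewrite /dotv mulr_sumr; apply: eq_bigr => i _; rewrite mxE mulrA. Qed.

Lemma dotvNl u v : dotv (- u) v = - dotv u v.
Proof. by rewrite -scaleN1r dotvZl mulN1r. Qed.

Lemma dotvDr u v w : dotv u (v + w) = dotv u v + dotv u w.
Proof. by rewrite dotvC dotvDl !(dotvC u). Qed.

Lemma dotvZr (c : R) u v : dotv u (c *: v) = c * dotv u v.
Proof. by rewrite dotvC dotvZl dotvC. Qed.

Lemma dotvNr u v : dotv u (- v) = - dotv u v.
Proof. by rewrite dotvC dotvNl dotvC. Qed.

Definition dotvE := (dotvDl, dotvDr, dotvNl, dotvNr, dotvZl, dotvZr).

Lemma dotv_ge0 u : 0 <= dotv u u.
Proof. by apply: sumr_ge0 => i _; rewrite -expr2 sqr_ge0. Qed.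

Lemma enorm_sqr u : enorm u ^+ 2 = dotv u u.
Proof. by rewrite sqr_sqrtr// dotv_ge0. Qed.

Lemma dotv_le_half u v : `|dotv u v| <= (dotv u u + dotv v v) / 2.
Proof.
have := dotv_ge0 (u + v); have := dotv_ge0 (u - v).
rewrite !dotvE (dotvC v u) ler_norml => H1 H2; apply/andP; split; lra.
Qed.

Lemma dotvDD_le u v : dotv (u + v) (u + v) <= 2 * dotv u u + 2 * dotv v v.
Proof. by have := dotv_ge0 (u - v); rewrite !dotvE (dotvC v u); lra. Qed.

Lemma dotvBB_le u v : dotv (u - v) (u - v) <= 2 * dotv u u + 2 * dotv v v.
Proof. by have := dotv_ge0 (u + v); rewrite !dotvE (dotvC v u); lra. Qed.

Lemma dotv_eq0 u : dotv u u = 0 -> u = 0.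
Proof.
move=> /eqP; rewrite psumr_eq0; last by move=> i _; rewrite -expr2 sqr_ge0.
move=> /allP u0; apply/rowP => i; rewrite mxE.
have := u0 i; rewrite mem_index_enum => /(_ isT) /=.
by rewrite mulf_eq0 orbb => /eqP.
Qed.

(** Multiplied by |v|^2, the gap between the two sides is the square of | |v|^2 u - <u, v> v |. *)
Lemma dotv_CauchySchwarz u v : dotv u v ^+ 2 <= dotv u u * dotv v v.
Proof.
have [/eqP v0|v0] := eqVneq (dotv v v) 0.
  rewrite (dotv_eq0 (eqP v0)).
  by rewrite -(scale0r v) !dotvE !mul0r mulr0 expr0n.
have vv : 0 < dotv v v by rewrite lt_def v0 dotv_ge0.
rewrite -subr_ge0 -(pmulr_rge0 _ vv).
have := dotv_ge0 (dotv v v *: u - dotv u v *: v).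
rewrite !dotvE (dotvC v u).
by congr (_ <= _); ring.
Qed.

(** Together with [dotv_le_norm_sqr], this carries limits between Euclidean distances and the
    sup-norm topology. *)
Lemma norm_sqr_le_dotv u : `|u| ^+ 2 <= dotv u u.
Proof.
have [->|u0] := eqVneq u 0; first by rewrite normr0 expr0n/= dotv_ge0.
have [[i j] /= ->] : exists i, `|u| = `|u i.1 i.2|.
  by apply: mx_norm_neq0; rewrite -[mx_norm u]/(`|u|) normr_eq0.
rewrite (ord1 i) /dotv (bigD1 j)//= real_normK ?num_real// -expr2 lerDl.
by apply: sumr_ge0 => k _; rewrite -expr2 sqr_ge0.
Qed.

Lemma dotv_le_norm_sqr u : dotv u u <= p%:R * `|u| ^+ 2.
Proof.
apply: (@le_trans _ _ (\sum_(i < p) `|u| ^+ 2)); last first.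
  by rewrite sumr_const card_ord mulr_natl.
apply: ler_sum => i _; rewrite -expr2 -real_normK ?num_real//.
by rewrite lerXn2r ?nnegrE// [in leRHS]/Num.norm/= mx_normrE (le_bigmax _ _ (0, i)).
Qed.

Lemma cvgn_dotvB (x : nat -> 'rV[R]_p) (l : 'rV[R]_p) :
  (fun k => dotv (x k - l) (x k - l)) @ \oo --> (0 : R) -> x @ \oo --> l.
Proof.
move=> xl; apply/cvgrPdist_lt => e e0.
move/cvgr0Pnorm_lt : xl => /(_ _ (exprn_gt0 2 e0)); apply: filterS => k.
rewrite (ger0_norm (dotv_ge0 _)) distrC => /(le_lt_trans (norm_sqr_le_dotv _)).
by rewrite ltr_pXn2r// nnegrE// ltW.
Qed.

End Euclidean.

(** * One iteration of the scheme: potentials and energy *)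

Section OneStep.
Context {R : realType} {p : nat}.
Implicit Types X v e : 'rV[R]_p.

Definition pot_v (T : R) v := T ^+ 2 * dotv v v.

(** This is [Q_k], equal to T^2 (|v|^2 - |v - e|^2). It has no sign, hence the absolute value in
    [pot_ve_bound]. *)
Definition pot_ve (T : R) v e := T ^+ 2 * (2 * dotv v e - dotv e e).

(** [X] stands for x_k - z, with z a zero of G, and [T] for [T_k]; primed vectors below belong to
    iteration k + 1. *)
Definition energy (w T : R) X v e :=
  2^-1 * pot_v T v + w * T * dotv X v + w ^+ 2 * dotv X X
  - 4^-1 * pot_ve T v e.

Variables (w T : R) (X v e v' e' : 'rV[R]_p).
Hypothesis w_gt2 : 2 < w.
Hypothesis T_ge : 2 * w + 1 <= T.
Hypothesis v'E : (T + 1) *: v' = (T - 2 * w) *: v + (w + 1) *: e.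

Let D := dotv v v + dotv e e.

Let v'_dot u : (T + 1) * dotv v' u = (T - 2 * w) * dotv v u + (w + 1) * dotv e u.
Proof. by rewrite -dotvZl v'E !dotvE. Qed.

Let pot_v_step_eq : pot_v (T + 1) v' = (T - 2 * w) ^+ 2 * dotv v v +
  2 * (T - 2 * w) * (w + 1) * dotv v e + (w + 1) ^+ 2 * dotv e e.
Proof.
rewrite /pot_v expr2 -mulrA v'_dot mulrDr mulrCA (mulrCA (T + 1)).
rewrite (dotvC v) (dotvC e) !v'_dot (dotvC e v); ring.
Qed.

(** The recursion for [v'] makes the new potential an explicit quadratic form in [v] and [e], whose
    T^2 part is the old one. The error term is shared with [pot_ve_step_le], so that one convergence
    argument serves both potentials. *)
Lemma pot_v_step : pot_v T v <= pot_v (T + 1) v' + 8 * w * T * D.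
Proof.
move: w_gt2 T_ge => w2 hT.
rewrite pot_v_step_eq /pot_v /D.
have := dotv_le_half v e; rewrite ler_norml => /andP[+ _].
have := dotv_ge0 v; have := dotv_ge0 e.
move: (dotv v v) (dotv v e) (dotv e e) => a b d d0 a0 hb.
(* The facts [h1] to [h8] are products of nonnegative factors; the goal is a linear combination of
   them in which monomials count as atoms. The later estimates follow the same pattern. *)
have h1 : 0 <= (T - 2 * w) * (w + 1) * (b + (a + d) / 2).
  by rewrite !mulr_ge0//; lra.
have h2 : 0 <= T * w * d by rewrite !mulr_ge0//; lra.
have h3 : 0 <= T * (w - 1) * (a + d) by rewrite !mulr_ge0//; lra.
have h4 : 0 <= w * w * a by rewrite !mulr_ge0//; lra.
have h5 : 0 <= w * (w + 1) * (a + d) by rewrite !mulr_ge0//; lra.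
have h6 : 0 <= T * w * a by rewrite !mulr_ge0//; lra.
have h7 : 0 <= (w + 1) * (w + 1) * d by rewrite !mulr_ge0//; lra.
have h8 : 0 <= T * (a + d) by rewrite !mulr_ge0//; lra.
lra.
Qed.

Hypothesis mono : dotv (e' - e) (e' - e) <= dotv (e' - e) (v' - e).

(** By [mono] and |e' - e|^2 >= 0, the quantity 2 <v', u> - |u|^2 does not decrease when u passes
    from [e] to [e']. After multiplication by (T + 1)^2 the recursion eliminates <v', e>. *)
Lemma pot_ve_step : pot_ve T v e +
  2 * ((T - 2 * w * T - 2 * w) * dotv v e + (T * w + w + 2^-1) * dotv e e) <=
  pot_ve (T + 1) v' e'.
Proof.
move: w_gt2 T_ge => w2 hT.
have /(ler_wpM2l (sqr_ge0 (T + 1))) : 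
    2 * dotv v' e - dotv e e <= 2 * dotv v' e' - dotv e' e'.
  have := dotv_ge0 (e' - e); move: mono; rewrite !dotvE.
  by rewrite (dotvC e e') (dotvC e' v') (dotvC e v'); lra.
have := congr1 (fun r => (T + 1) * r) (v'_dot e).
rewrite /pot_ve; move: (dotv v' e) => s3; lra.
Qed.

Lemma pot_ve_step_le : pot_ve T v e <= pot_ve (T + 1) v' e' + 8 * w * T * D.
Proof.
move: w_gt2 T_ge => w2 hT.
apply: le_trans (lerD pot_ve_step (lexx _)).
rewrite /D; have := dotv_le_half v e; rewrite ler_norml => /andP[_ +].
have := dotv_ge0 v; have := dotv_ge0 e.
move: (dotv v v) (dotv v e) (dotv e e) => a b d d0 a0 hb.
have h1 : 0 <= (2 * w * T + 2 * w - T) * ((a + d) / 2 - b).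
  apply: mulr_ge0; last lra.
  have : 0 <= w * T by rewrite mulr_ge0//; lra.
  have : 0 <= (w - 2) * T by rewrite mulr_ge0//; lra.
  lra.
have h2 : 0 <= T * w * (a + d) by rewrite !mulr_ge0//; lra.
have h3 : 0 <= (T - 1) * w * (a + d) by rewrite !mulr_ge0//; lra.
have h4 : 0 <= (T * w + w + 2^-1) * d.
  by rewrite mulr_ge0// !addr_ge0// ?mulr_ge0//; lra.
have h5 : 0 <= T * (a + d) by rewrite !mulr_ge0//; lra.
lra.
Qed.

Hypothesis zer_e : 0 <= dotv (X + v) e.

(** The weights w T and w^2 make the terms in <X, v> cancel. What remains of <X, e> is -w (w - 1)
    <X, e>, which [zer_e] bounds by w (w - 1) <v, e>. The surviving form in [v] and [e] is positive
    at order T since w > 2, and 2 w^2 D covers the terms of order 1. *)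
Lemma energy_step :
  energy w (T + 1) (X + v - e) v' e' + (T / 16 - 2 * w ^+ 2) * D <=
  energy w T X v e.
Proof.
move: w_gt2 T_ge => w2 hT.
rewrite /energy pot_v_step_eq; move: pot_ve_step; rewrite -(mulrA w (T + 1)).
rewrite [dotv _ v']dotvC v'_dot /D.
have := dotv_le_half v e; rewrite ler_norml => /andP[hb _].
(* Absorbs the cross term of the O(T) part of the decrease:
   [w |v|^2 - (w + 1/2) <v, e> + w |e|^2 / 2 >= (|v|^2 + |e|^2) / 16]. *)
have hq := dotv_ge0 (v - (3 / 4) *: e).
have ha := dotv_ge0 v; have hd := dotv_ge0 e.
move: zer_e hq hb ha hd; rewrite /pot_v !dotvE.
rewrite (dotvC e v) (dotvC v X) (dotvC e X).
move: (dotv v v) (dotv v e) (dotv e e) (dotv X v) (dotv X e) (dotv X X).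
move=> a b d xv xe xx hz hq hb ha hd.
set Q' := pot_ve (T + 1) v' e'; set Q := pot_ve T v e => hQ.
have h1 : 0 <= w * (w - 1) * (xe + b) by rewrite !mulr_ge0//; lra.
have h2 : 0 <= T * (w + 1 / 2) * (a - (3 / 2) * b + (9 / 16) * d).
  by rewrite !mulr_ge0//; lra.
have h3 : 0 <= T * (w - 2) * a by rewrite !mulr_ge0//; lra.
have h4 : 0 <= T * (w - 2) * d by rewrite !mulr_ge0//; lra.
have h5 : 0 <= T * a by rewrite !mulr_ge0//; lra.
have h6 : 0 <= T * d by rewrite !mulr_ge0//; lra.
have h7 : 0 <= w * (b + (a + d) / 2) by rewrite !mulr_ge0//; lra.
have h8 : 0 <= w * (w - 2) * a by rewrite !mulr_ge0//; lra.
have h9 : 0 <= w * (w - 2) * d by rewrite !mulr_ge0//; lra.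
have h10 : 0 <= (w - 2) * a by rewrite !mulr_ge0//; lra.
have h11 : 0 <= (w - 2) * d by rewrite !mulr_ge0//; lra.
lra.
Qed.

(** Sixteen times the energy is 4 |T v - T e + w X|^2 + 4 |T v + w X|^2 + 8 w^2 |X|^2 + 8 w T <X,
    e>. The squares dominate T^2 D + 6 w^2 |X|^2, while [zer_e] and T >= 8 w keep the last term
    above -T^2 D / 2. *)
Lemma energy_ge : 8 * w <= T ->
  2^-1 * T ^+ 2 * D + w ^+ 2 * dotv X X <= 16 * energy w T X v e.
Proof.
move: w_gt2 T_ge => w2 hT Tw; rewrite /energy /pot_v /pot_ve /D.
have H1 := dotvBB_le (T *: v - T *: e + w *: X) (T *: v + w *: X).
have H2 := dotvBB_le (T *: v + w *: X) (w *: X).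
have H3 := dotv_ge0 (T *: v - T *: e + w *: X).
have H4 := dotv_ge0 (T *: v + w *: X).
have hb := dotv_le_half v e; rewrite ler_norml in hb.
have ha := dotv_ge0 v; have hd := dotv_ge0 e; have hx := dotv_ge0 X.
move: zer_e H1 H2 H3 H4 hb ha hd hx; rewrite !dotvE.
rewrite (dotvC e v) (dotvC v X) (dotvC e X).
move: (dotv v v) (dotv v e) (dotv e e) (dotv X v) (dotv X e) (dotv X X).
move=> a b d xv xe xx hz H1 H2 H3 H4 /andP[hb1 hb2] ha hd hx.
have h1 : 0 <= w * T * (xe + b) by rewrite !mulr_ge0//; lra.
have h2 : 0 <= w * T * ((a + d) / 2 - b) by rewrite !mulr_ge0//; lra.
have h3 : 0 <= (T - 8 * w) * T * (a + d) by rewrite !mulr_ge0//; lra.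
have h4 : 0 <= w ^+ 2 * xx by rewrite !mulr_ge0//; lra.
lra.
Qed.

Lemma pot_v_bound : pot_v T v <= T ^+ 2 * D.
Proof. by rewrite /pot_v ler_wpM2l// ?sqr_ge0// lerDl dotv_ge0. Qed.

Lemma pot_ve_bound : `|pot_ve T v e| <= 2 * (T ^+ 2 * D).
Proof.
rewrite /pot_ve normrM ger0_norm ?sqr_ge0// mulrCA ler_wpM2l// ?sqr_ge0//.
have := dotv_le_half v e; rewrite !ler_norml => /andP[h1 h2].
have := dotv_ge0 v; have := dotv_ge0 e; rewrite /D => h3 h4.
by apply/andP; split; lra.
Qed.

(** Both coefficients of the recursion lie between 0 and T + 1. This bounds y_{k+1} - y_k = v_{k+1}
    - e_k by [D] at rank k alone. *)
Lemma dotv_step_le : dotv v' v' <= 2 * D.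
Proof.
move: w_gt2 T_ge => w2 hT.
have T1 : 0 < (T + 1) ^+ 2 by rewrite exprn_gt0//; lra.
have h2 : (T - 2 * w) ^+ 2 <= (T + 1) ^+ 2 by apply: lerXn2r; rewrite ?nnegrE; lra.
have h3 : (w + 1) ^+ 2 <= (T + 1) ^+ 2 by apply: lerXn2r; rewrite ?nnegrE; lra.
rewrite -(ler_pM2l T1).
have := dotvDD_le ((T - 2 * w) *: v) ((w + 1) *: e); rewrite -v'E !dotvE /D.
have := ler_wpM2r (dotv_ge0 v) h2; have := ler_wpM2r (dotv_ge0 e) h3; lra.
Qed.

End OneStep.

(** * Summability, rates and convergence of distances along the iteration *)

Section Asymptotics.
Context {R : realType} {p : nat}.
Variables (w : R) (x v e : nat -> 'rV[R]_p).

Let T k : R := k%:R + 2 * w + 1.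
Let D k := dotv (v k) (v k) + dotv (e k) (e k).

Hypothesis w_gt2 : 2 < w.
Hypothesis vS : forall k,
  (T k + 1) *: v k.+1 = (T k - 2 * w) *: v k + (w + 1) *: e k.
Hypothesis xS : forall k, x k.+1 = x k + v k - e k.
Hypothesis mono : forall k,
  dotv (e k.+1 - e k) (e k.+1 - e k) <= dotv (e k.+1 - e k) (v k.+1 - e k).

Let TS k : T k.+1 = T k + 1.
Proof. by rewrite /T -natr1; ring. Qed.

Let T_ge k : 2 * w + 1 <= T k.
Proof. by rewrite /T -addrA lerDr. Qed.

Let T_gt0 k : 0 < T k.
Proof. by have := T_ge k; have := w_gt2; lra. Qed.

Let T_large B : exists K, forall k, (K <= k)%N -> B <= T k.
Proof.
exists `|Num.ceil B|%N => k /= Kk; have := w_gt2; rewrite /T => w2.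
suff : B <= k%:R by lra.
apply: (le_trans (ceil_ge B)); apply: (@le_trans _ _ `|Num.ceil B|%N%:R).
  by rewrite natr_absz ler_int ler_norm.
by rewrite ler_nat.
Qed.

Let D_ge0 k : 0 <= D k.
Proof. by rewrite addr_ge0// dotv_ge0. Qed.

Let TD_ge0 k : 0 <= T k * D k.
Proof. by rewrite mulr_ge0// ltW. Qed.

Let zero_of (z : 'rV[R]_p) := forall k, 0 <= dotv (x k - z + v k) (e k).

Let E (z : 'rV[R]_p) k := energy w (T k) (x k - z) (v k) (e k).

Lemma energy_eventually z : zero_of z -> exists K, forall k, (K <= k)%N ->
  E z k.+1 + 32^-1 * (T k * D k) <= E z k /\
  2^-1 * (T k ^+ 2 * D k) + w ^+ 2 * dotv (x k - z) (x k - z) <= 16 * E z k.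
Proof.
(* From T >= 64 w^2 follow both T / 16 - 2 w^2 >= T / 32 and T >= 8 w. *)
move=> ze; have [K HK] := T_large (64 * w ^+ 2); exists K => k /HK Tk.
have w2 := w_gt2; split.
  have XS : x k.+1 - z = x k - z + v k - e k.
    by rewrite xS addrAC (addrAC (x k)).
  have := energy_step w_gt2 (T_ge k) (vS k) (mono k) (ze k).
  rewrite -/(D k) -XS -TS => /(le_trans _); apply; rewrite /E.
  by rewrite lerD2l mulrA ler_wpM2r//; lra.
rewrite mulrA; apply: energy_ge (ze k) _ => //.
apply: le_trans Tk; rewrite expr2 mulrA ler_wpM2r//; lra.
Qed.

Variable z0 : 'rV[R]_p.
Hypothesis z0_zero : zero_of z0.

Lemma bounded_sums_TD : bounded_sums (fun k => T k * D k).
Proof.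
have [K HK] := energy_eventually z0_zero.
apply: (@bounded_sums_le _ 0 32 _ (fun k => 32^-1 * (T k * D k))) => //.
- by move=> k; rewrite mulr_ge0.
- by move=> k _; rewrite mulrA divff// mul1r.
apply: (@bounded_sums_telescope _ K _ (E z0)) => k /HK[//].
have := mulr_ge0 (sqr_ge0 (T k)) (D_ge0 k); have := dotv_ge0 (x k - z0).
move=> /(mulr_ge0 (sqr_ge0 w)); lra.
Qed.

Lemma eventually_bounded z : zero_of z -> exists B K, forall k, (K <= k)%N ->
  T k ^+ 2 * D k <= B /\ dotv (x k - z) (x k - z) <= B.
Proof.
move=> /energy_eventually[K HK]; exists (32 * E z K), K => k Kk.
have EK : E z k <= E z K.
  elim: k Kk => [|k ih]; first by rewrite leqn0 => /eqP ->.
  rewrite leq_eqVlt => /predU1P[<-//|]; rewrite ltnS => Kk.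
  apply: le_trans (ih Kk); have [+ _] := HK k Kk; have := TD_ge0 k; lra.
have [_ H] := HK k Kk; have w2 := w_gt2.
have TD := mulr_ge0 (sqr_ge0 (T k)) (D_ge0 k); have xz := dotv_ge0 (x k - z).
have wx : dotv (x k - z) (x k - z) <= w ^+ 2 * dotv (x k - z) (x k - z).
  by rewrite ler_peMl// exprn_ege1//; lra.
by split; lra.
Qed.

Lemma energy_cvg z : zero_of z -> cvgn (E z).
Proof.
move=> /energy_eventually[K HK].
(* The energy is eventually nonincreasing and nonnegative, so its opposite fits the quasi-monotone
   criterion with zero error. *)
have -> : E z = - (- E z) by rewrite opprK.
apply: is_cvgN; apply: (@cvgn_quasi_nondecreasing _ K 0 (fun=> 0)) => //.
- by exists 0 => n; rewrite big1.
- move=> k /HK[+ _]; rewrite !fctE; have := TD_ge0 k; lra.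
- move=> k /HK[_]; rewrite fctE.
  have := mulr_ge0 (sqr_ge0 (T k)) (D_ge0 k); have := dotv_ge0 (x k - z).
  move=> /(mulr_ge0 (sqr_ge0 w)); lra.
Qed.

Lemma bounded_sums_increments : bounded_sums (fun k => 8 * w * (T k * D k)).
Proof.
have w2 := w_gt2.
by apply: (@bounded_sums_le _ 0 (8 * w)) bounded_sums_TD => //; lra.
Qed.

(** The errors are summable and [u] is eventually bounded, so [u] converges. Since T_k <= (2 w + 1)
    (k + 1), the bound on [u] makes |u_k| / (k + 1) of order T_k D_k, hence summable, which forces
    the limit 0. *)
Lemma cvg0_of_quasi_nondecreasing (u : nat -> R) :
  (forall k, `|u k| <= 2 * (T k ^+ 2 * D k)) ->
  (forall k, u k <= u k.+1 + 8 * w * T k * D k) -> u @ \oo --> (0 : R).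
Proof.
move=> uD uS; have w2 := w_gt2.
have [B [K HK]] := eventually_bounded z0_zero.
apply: cvgn_bounded_sums_harmonic.
  apply: (@cvgn_quasi_nondecreasing _ K (2 * B) _ _ _ bounded_sums_increments).
  - by move=> k; rewrite mulr_ge0//; lra.
  - by move=> k _; rewrite mulrA.
  - move=> k /HK[+ _]; have := uD k; rewrite ler_norml => /andP[_ +]; lra.
apply: (@bounded_sums_le _ 0 (2 * (2 * w + 1))) bounded_sums_TD => //; first lra.
move=> k _; rewrite ler_pdivrMr ?ltr0n//; apply: le_trans (uD k) _.
have : T k <= (2 * w + 1) * k.+1%:R.
  rewrite /T -natr1 -subr_ge0.
  have : 0 <= k%:R * w by rewrite mulr_ge0//; lra.
  lra.
move=> /(ler_wpM2r (TD_ge0 k)); lra.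
Qed.

Lemma pot_v_cvg0 : (fun k => pot_v (T k) (v k)) @ \oo --> (0 : R).
Proof.
apply: cvg0_of_quasi_nondecreasing => k.
  rewrite ger0_norm ?(mulr_ge0 (sqr_ge0 _) (dotv_ge0 _))//.
  have := pot_v_bound (T k) (v k) (e k).
  have := mulr_ge0 (sqr_ge0 (T k)) (D_ge0 k); rewrite -/(D k); lra.
by rewrite /= TS; exact: pot_v_step.
Qed.

Lemma pot_ve_cvg0 : (fun k => pot_ve (T k) (v k) (e k)) @ \oo --> (0 : R).
Proof.
apply: cvg0_of_quasi_nondecreasing => k; first exact: pot_ve_bound.
by rewrite /= TS; exact: pot_ve_step_le.
Qed.

(** The upper bound comes from 5 |v|^2 - 2 (2 <v, e> - |e|^2) - (|v|^2 + |e|^2) = |2 v - e|^2. *)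
Lemma T2D_cvg0 : (fun k => T k ^+ 2 * D k) @ \oo --> (0 : R).
Proof.
apply: (@squeeze_cvgr _ _ _ _ (fun=> 0)
  (fun k => 5 * pot_v (T k) (v k) - 2 * pot_ve (T k) (v k) (e k))).
- apply: nearW => k; rewrite mulr_ge0 ?sqr_ge0//=.
  rewrite /pot_v /pot_ve /D; have := dotv_ge0 (2 *: v k - e k).
  move=> /(mulr_ge0 (sqr_ge0 (T k))); rewrite !dotvE (dotvC (e k)); lra.
- exact: cvg_cst.
- rewrite -[0](_ : 5 * 0 - 2 * 0 = 0 :> R); last by rewrite !mulr0 subr0.
  by apply: cvgB; apply: cvgMl_tmp; [exact: pot_v_cvg0|exact: pot_ve_cvg0].
Qed.

(** In the convergent energy every term but w^2 |x_k - z|^2 tends to 0; for the cross term this is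
    Cauchy-Schwarz, |x_k - z| being bounded and T_k |v_k| tending to 0. *)
Lemma dist_sqr_cvg z : zero_of z -> cvgn (fun k => dotv (x k - z) (x k - z)).
Proof.
move=> ze; have w2 := w_gt2; have [B [K HK]] := eventually_bounded ze.
have cross : (fun k => T k * dotv (x k - z) (v k)) @ \oo --> (0 : R).
  apply: norm_cvg0.
  apply: (@squeeze_cvgr _ _ _ _ (fun=> 0)
    (fun k => Num.sqrt (B * pot_v (T k) (v k)))).
  - near=> k; rewrite normr_ge0/= -sqrtr_sqr ler_wsqrtr//.
    rewrite exprMn /pot_v (mulrCA B) ler_wpM2l ?sqr_ge0//.
    apply: le_trans (dotv_CauchySchwarz _ _) _; rewrite ler_wpM2r ?dotv_ge0//.
    by have /HK[] : (K <= k)%N by near: k; exists K.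
  - exact: cvg_cst.
  - rewrite -[0]sqrtr0 -[in Num.sqrt 0](mulr0 B).
    by apply: continuous_cvg; [exact: sqrt_continuous|apply: cvgMl_tmp pot_v_cvg0].
have w20 : w ^+ 2 != 0 by rewrite expf_neq0//; lra.
have /cvg_ex[l El] := energy_cvg ze.
(* The zeros are the limits of the vanishing terms, kept so that the witness has the shape the limit
   rules produce. *)
apply/cvg_ex; exists (w ^- 2 * (l - 2^-1 * 0 - w * 0 + 4^-1 * 0)).
rewrite (_ : (fun k => _) = fun k => w ^- 2 * (E z k - 2^-1 * pot_v (T k) (v k)
  - w * (T k * dotv (x k - z) (v k)) + 4^-1 * pot_ve (T k) (v k) (e k))).
  apply: cvgMl_tmp; apply: cvgD; last exact: cvgMl_tmp pot_ve_cvg0.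
  apply: cvgB; last exact: cvgMl_tmp cross.
  by apply: cvgB => //; exact: cvgMl_tmp pot_v_cvg0.
apply/funext => k; apply: (mulfI w20); rewrite mulVKf// /E /energy; lra.
Unshelve. all: by end_near. Qed.

(** Each of the five lines of the theorem is an instance. *)
Lemma rate_of_le (W a : nat -> R) (C : R) : 0 <= C ->
  (forall k, 0 <= W k <= T k) -> (forall k, 0 <= a k <= C * D k) ->
  (\sum_(0 <= k <oo) (W k * a k)%:E < +oo)%E /\ little_o_inv_sq a.
Proof.
move=> C0 WT aD; split.
  apply: nneseries_lty_bounded_sums => [k|].
    by have /andP[? _] := WT k; have /andP[? _] := aD k; rewrite mulr_ge0.
  apply: (@bounded_sums_le _ 0 C) bounded_sums_TD => // k _.
  rewrite mulrCA; have /andP[? ?] := WT k; have /andP[? ?] := aD k.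
  by rewrite ler_pM.
apply: little_o_inv_sq_cvg0.
apply: (@squeeze_cvgr _ _ _ _ (fun=> 0) (fun k => C * (T k ^+ 2 * D k))).
- apply: nearW => k; have /andP[a0 aC] := aD k.
  rewrite mulr_ge0 ?exprn_ge0//= mulrCA ler_pM ?exprn_ge0//.
  have kT : k%:R <= T k by have := w_gt2; rewrite /T; lra.
  by apply: lerXn2r; rewrite ?nnegrE// (le_trans _ kT).
- exact: cvg_cst.
- by rewrite -[0](mulr0 C); exact: cvgMl_tmp T2D_cvg0.
Qed.

Lemma D_cvg0 : D @ \oo --> (0 : R).
Proof.
apply: (@squeeze_cvgr _ _ _ _ (fun=> 0) (fun k => T k ^+ 2 * D k)).
- apply: nearW => k; rewrite D_ge0/= ler_peMl// exprn_ege1//.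
  by have := T_ge k; have := w_gt2; lra.
- exact: cvg_cst.
- exact: T2D_cvg0.
Qed.

End Asymptotics.

(** * Opial's argument in finite dimension *)

Section Opial.
Context {R : realType} {p : nat}.
Implicit Types (x : nat -> 'rV[R]_p) (c z : 'rV[R]_p).

Lemma nbhs_dotvB c (r : R) : 0 < r -> nbhs c [set u | dotv (u - c) (u - c) < r].
Proof.
(* Dividing by p + 1 rather than p also covers dimension 0. *)
move=> r0; have s0 : 0 < Num.sqrt (r / p.+1%:R).
  by rewrite sqrtr_gt0 divr_gt0// ltr0n.
apply: filterS (nbhsx_ballx c _ s0) => u; rewrite -ball_normE/= distrC => uc.
apply: (le_lt_trans (dotv_le_norm_sqr _)).
have H : `|u - c| ^+ 2 < r / p.+1%:R.
  rewrite -[ltRHS]sqr_sqrtr; last by rewrite divr_ge0// ltW.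
  by rewrite ltr_pXn2r// nnegrE// ltW.
rewrite ltr_pdivlMr ?ltr0n// in H; apply: le_lt_trans H.
by rewrite mulrC ler_wpM2l ?exprn_ge0// ler_nat.
Qed.

(** Convergence of the distance to one point of [Z] bounds [x], so compactness gives a cluster point
    c, which lies in [Z]. The distance to c then converges too, and a nonzero limit would keep [x]
    away from c. *)
Lemma opial x (Z : set 'rV[R]_p) : Z !=set0 ->
  (forall z, Z z -> cvgn (fun k => dotv (x k - z) (x k - z))) ->
  cluster (x @ \oo) `<=` Z -> exists2 c, Z c & x @ \oo --> c.
Proof.
move=> [z Zz] xZ clZ; have /cvg_ex[l xl] := xZ z Zz.
(* Eventually t = |x_k - z| satisfies t^2 < l + 1, and 2 t <= t^2 + 1 gives t <= l + 2. *)
pose M := `|z| + (l + 2).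
have cA : compact [set u : 'rV[R]_p | `|u| <= M].
  apply: bounded_closed_compact.
    by exists M; split; [exact: num_real|move=> N MN u /le_trans; apply; exact: ltW].
  apply: (@preimage_closed _ _ (fun u : 'rV[R]_p => `|u|) [set r | r <= M]).
    by move=> u _; exact: norm_continuous.
  exact: closed_le.
have xA : (x @ \oo) [set u : 'rV[R]_p | `|u| <= M].
  move/cvgrPdist_lt : xl => /(_ 1 ltr01); apply: filterS => k.
  rewrite ltr_distlC => /andP[_ xkl] /=.
  have := ler_normD (x k - z) z; rewrite subrK.
  have := norm_sqr_le_dotv (x k - z); have := sqr_ge0 (`|x k - z| - 1).
  have := normr_ge0 (x k - z); rewrite /M; lra.
have [c [_ cc]] := cA _ _ xA; exists c; first exact: clZ.
apply: cvgn_dotvB; have /cvg_ex[m xm] := xZ c (clZ _ cc).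
have [m0|m0] := eqVneq m 0; first by move: xm; rewrite m0.
have m2 : 0 < `|m| / 2 by rewrite divr_gt0// normr_gt0.
have xF : (x @ \oo) [set u | `|m| / 2 < dotv (u - c) (u - c)].
  move/cvgrPdist_lt : xm => /(_ _ m2); apply: filterS => k /= mk.
  have := ler_normD (m - dotv (x k - c) (x k - c)) (dotv (x k - c) (x k - c)).
  by rewrite subrK [`|dotv _ _|]ger0_norm ?dotv_ge0//; lra.
have [u [/= u1 u2]] := cc _ _ xF (nbhs_dotvB c m2).
by have := lt_trans u1 u2; rewrite ltxx.
Qed.

End Opial.

(** * Lipschitz continuity and cluster points for a co-coercive operator *)

Section Cocoercive.
Context {R : realType} {p : nat}.
Variables (G : 'rV[R]_p -> 'rV[R]_p) (L : R).
Hypotheses (L_gt0 : 0 < L) (G_coco : cocoercive L^-1 G).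

(** With d = G u - G z and h = u - z, co-coercivity reads |d|^2 <= L <d, h>, and |d - L h|^2 >= 0
    absorbs the product. *)
Lemma cocoercive_lipschitz u z :
  dotv (G u - G z) (G u - G z) <= L ^+ 2 * dotv (u - z) (u - z).
Proof.
have := G_coco u z; rewrite enorm_sqr.
rewrite -(ler_pM2l L_gt0) mulrA divff ?gt_eqF// mul1r.
move: (G u - G z) (u - z) => d h.
have := dotv_ge0 (d - L *: h); rewrite !dotvE (dotvC h d); lra.
Qed.

Lemma cluster_zer (x : nat -> 'rV[R]_p) :
  (fun k => dotv (G (x k)) (G (x k))) @ \oo --> (0 : R) ->
  cluster (x @ \oo) `<=` zer G.
Proof.
move=> Gx c cc; apply: dotv_eq0; apply/eqP; rewrite eq_le dotv_ge0 andbT.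
apply/ler_addgt0Pr => r r0; rewrite add0r.
(* If |G u|^2 and |u - c|^2 are below [s], then |G c|^2 <= 2 |G u|^2 + 2 L^2 |u - c|^2 <= (2 + 2
   L^2) s = r. *)
have s0 : 0 < r / (2 + 2 * L ^+ 2).
  by rewrite divr_gt0// addr_gt0// mulr_gt0// exprn_gt0.
set s := r / _ in s0; have rE : (2 + 2 * L ^+ 2) * s = r.
  by rewrite mulrC divfK// gt_eqF// addr_gt0// mulr_gt0// exprn_gt0.
have xF : (x @ \oo) [set u | dotv (G u) (G u) < s].
  move/cvgr0Pnorm_lt : Gx => /(_ _ s0); apply: filterS => k /=.
  by rewrite ger0_norm ?dotv_ge0.
have [u [/= u1 u2]] := cc _ _ xF (nbhs_dotvB c s0).
have := cocoercive_lipschitz u c.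
have := dotvBB_le (G u) (G u - G c); rewrite subKr -rE.
have := ler_wpM2l (sqr_ge0 L) (ltW u2); lra.
Qed.

End Cocoercive.

(** * Application to the accelerated scheme *)

Theorem theorem3 (R : realType) (p : nat) (G : 'rV[R]_p -> 'rV[R]_p)
    (L omega gamma : R) (x y : nat -> 'rV[R]_p)
    (L_gt0 : 0 < L)
    (G_coco : cocoercive L^-1 G)
    (zerG : zer G !=set0)
    (omega_gt2 : 2 < omega)
    (gamma_gt0 : 0 < gamma) (gamma_lt : gamma < L^-1)
    (xy0 : x 0%N = y 0%N)
    (xS : forall k, x k.+1 = y k - gamma *: G (y k))
    (yS : forall k, y k.+1 = x k.+1 + theta omega k *: (x k.+1 - x k)
                               + nu omega k *: (y k - x k.+1)) :
  (forall k, 0 < nu omega k < 1) /\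
  ((\sum_(0 <= k <oo)
      ((k%:R + omega + 1) * enorm (x k.+1 - x k) ^+ 2)%:E < +oo)%E /\
   little_o_inv_sq (fun k => enorm (x k.+1 - x k) ^+ 2)) /\
  ((\sum_(0 <= k <oo)
      ((k%:R + 2 * omega + 1) * enorm (y k - x k) ^+ 2)%:E < +oo)%E /\
   little_o_inv_sq (fun k => enorm (y k - x k) ^+ 2)) /\
  ((\sum_(0 <= k <oo)
      ((k%:R + omega + 1) * enorm (G (y k)) ^+ 2)%:E < +oo)%E /\
   little_o_inv_sq (fun k => enorm (G (y k)) ^+ 2)) /\
  ((\sum_(0 <= k <oo)
      ((k%:R + omega + 1) * enorm (G (x k)) ^+ 2)%:E < +oo)%E /\
   little_o_inv_sq (fun k => enorm (G (x k)) ^+ 2)) /\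
  ((\sum_(0 <= k <oo)
      ((k%:R + omega) * enorm (y k.+1 - y k) ^+ 2)%:E < +oo)%E /\
   little_o_inv_sq (fun k => enorm (y k.+1 - y k) ^+ 2)) /\
  (exists2 ystar, zer G ystar & x @ \oo --> ystar /\ y @ \oo --> ystar).
Proof.
set w := omega in xS yS *; have w2 : 2 < w := omega_gt2.
pose v k := y k - x k; pose e k := gamma *: G (y k).
pose T k : R := k%:R + 2 * w + 1.
have k0 k : (0 : R) <= k%:R by [].
have T_neq0 k : k%:R + 2 * w + 2 != 0 :> R.
  by rewrite gt_eqF//; have := k0 k; lra.
(* [T k + 1] is the common denominator of [theta] and [nu]. *)
have vS k : (T k + 1) *: v k.+1 = (T k - 2 * w) *: v k + (w + 1) *: e k.
  rewrite /v /e yS xS /theta /nu /T; apply/rowP => i; rewrite !mxE.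
  by field.
have xS' k : x k.+1 = x k + v k - e k by rewrite xS /v subrKC.
have ySB k : y k.+1 - y k = v k.+1 - e k.
  by rewrite /v /e xS opprB (addrC (gamma *: _)) addrA addrK.
(* Co-coercivity between consecutive [y], with 1/L weakened to [gamma] and both sides scaled by
   [gamma]. *)
have mono k :
    dotv (e k.+1 - e k) (e k.+1 - e k) <= dotv (e k.+1 - e k) (v k.+1 - e k).
  have := G_coco (y k.+1) (y k); rewrite enorm_sqr -ySB -scalerBr.
  move: (G _ - G _) (y k.+1 - y k) => d h; rewrite !dotvE => H; rewrite ler_pM2l//.
  by apply: le_trans H; rewrite ler_wpM2r ?dotv_ge0// ltW.
have zero z : zer G z -> forall k, 0 <= dotv (x k - z + v k) (e k).
  move=> Gz k; rewrite /v /e addrAC subrKC dotvZr.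
  have := G_coco (y k) z; rewrite Gz subr0 enorm_sqr dotvC => H.
  rewrite mulr_ge0 ?(ltW gamma_gt0)//; apply: le_trans H.
  by rewrite mulr_ge0 ?dotv_ge0// invr_ge0 ltW.
have [z0 Gz0] := zerG.
have rate := rate_of_le w2 vS xS' mono (zero z0 Gz0).
pose D k := dotv (v k) (v k) + dotv (e k) (e k).
have vD k : dotv (v k) (v k) <= D k by rewrite lerDl dotv_ge0.
have eD k : dotv (e k) (e k) <= D k by rewrite lerDr dotv_ge0.
have GyD k : dotv (G (y k)) (G (y k)) <= gamma ^- 2 * D k.
  rewrite mulrC ler_pdivlMr ?exprn_gt0// mulrC expr2 -mulrA.
  rewrite -dotvZl -dotvZr; exact: eD.
(* Split G x_k = G y_k - (G y_k - G x_k); the Lipschitz bound controls the second part by |v_k|. *)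
have GxD k :
    dotv (G (x k)) (G (x k)) <= (2 * gamma ^- 2 + 2 * L ^+ 2) * D k.
  have := cocoercive_lipschitz L_gt0 G_coco (y k) (x k).
  have := dotvBB_le (G (y k)) (G (y k) - G (x k)); rewrite subKr -/(v k).
  have := GyD k; have := ler_wpM2l (sqr_ge0 L) (vD k); lra.
have C_ge0 : 0 <= gamma ^- 2 by rewrite invr_ge0 sqr_ge0.
have sum_rate (W : nat -> R) (u : nat -> 'rV[R]_p) (C : R) : 0 <= C ->
    (forall k, 0 <= W k <= T k) -> (forall k, dotv (u k) (u k) <= C * D k) ->
    (\sum_(0 <= k <oo) (W k * enorm (u k) ^+ 2)%:E < +oo)%E /\
    little_o_inv_sq (fun k => enorm (u k) ^+ 2).
  move=> C0 WT uD; apply: rate C0 WT _ => k.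
  by rewrite enorm_sqr dotv_ge0 uD.
have w1T k : 0 <= k%:R + w + 1 <= T k.
  by apply/andP; rewrite /T; have := k0 k; split; lra.
have w21T k : 0 <= k%:R + 2 * w + 1 <= T k.
  by apply/andP; rewrite /T; have := k0 k; split; lra.
have w0T k : 0 <= k%:R + w <= T k.
  by apply/andP; rewrite /T; have := k0 k; split; lra.
have GyR := sum_rate _ (fun k => G (y k)) _ C_ge0 w1T GyD.
split.
  move=> k; rewrite /nu; have dk : 0 < k%:R + 2 * w + 2 :> R.
    by have := k0 k; lra.
  by rewrite divr_gt0 ?ltr_pdivrMr//=; have := k0 k; lra.
split.
  apply: (sum_rate _ (fun k => x k.+1 - x k) 2) => // k.
  rewrite xS' addrAC (addrAC (x k)) subrr add0r.
  by have := dotvBB_le (v k) (e k); rewrite /D; lra.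
split; first by apply: (sum_rate _ v 1) => // k; rewrite mul1r.
split; first exact: GyR.
split.
  apply: (sum_rate _ (fun k => G (x k)) (2 * gamma ^- 2 + 2 * L ^+ 2)) => //.
  by rewrite addr_ge0// mulr_ge0// sqr_ge0.
split.
  (* The 6 is 2 * 2 + 2: |v_{k+1} - e_k|^2 <= 2 |v_{k+1}|^2 + 2 |e_k|^2 with |v_{k+1}|^2 <= 2
     D_k. *)
  apply: (sum_rate _ (fun k => y k.+1 - y k) 6) => // k.
  rewrite ySB; apply: (le_trans (dotvBB_le _ _)).
  have T_ge : 2 * w + 1 <= T k by rewrite /T; have := k0 k; lra.
  have := dotv_step_le w2 T_ge (vS k); have := eD k; rewrite -/(D k); lra.
have D0 : D @ \oo --> (0 : R) := D_cvg0 w2 vS xS' mono (zero z0 Gz0).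
have cvg0_le_D (a : nat -> R) (C : R) :
    (forall k, 0 <= a k <= C * D k) -> a @ \oo --> (0 : R).
  move=> aD; apply: (@squeeze_cvgr _ _ _ _ (fun=> 0) (fun k => C * D k)).
  - exact: nearW.
  - exact: cvg_cst.
  - by rewrite -[0](mulr0 C); exact: cvgMl_tmp D0.
have [c Gc xc] : exists2 c, zer G c & x @ \oo --> c.
  apply: opial => //.
    by move=> z Gz; exact: (dist_sqr_cvg w2 vS xS' mono (zero z0 Gz0) (zero z Gz)).
  apply/(cluster_zer L_gt0 G_coco)/cvg0_le_D => k.
  by rewrite dotv_ge0; exact: GxD.
exists c => //; split => //.
have -> : y = x \+ v by apply/funext => k; rewrite /v/= subrKC.
rewrite -[c]addr0; apply: cvgD xc _.
apply/cvgn_dotvB/(cvg0_le_D _ 1) => k.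
by rewrite subr0 dotv_ge0 mul1r/=.
Qed.
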